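(* Let $\mathcal{X}$ be a complex Banach space with $\dim \mathcal{X}\geq 2$, let $\mathcal{U}\subseteq B(\mathcal{X})$ be a standard operator algebra containing the identity operator $I$, let $n\geq 2$ be a fixed integer, and let $\phi:\mathcal{U}\rightarrow\mathcal{U}$ be a linear map. The following are equivalent: (i) $\phi$ is a Lie $n$-centralizer; (ii) there exist an element $\lambda\in\mathbb{C}$ and a linear map $\mu:\mathcal{U}\rightarrow\mathbb{C}$ such that $\phi(A)=\lambda A+\mu(A)I$ for all $A\in\mathcal{U}$ and $\mu(p_n(A_1,A_2,\dots,A_n))=0$ for all $A_1,A_2,\dots,A_n\in\mathcal{U}$.
   Context: All algebras and vector spaces are over $\mathbb{C}$. For a complex Banach space $\mathcal{X}$, $B(\mathcal{X})$ is the algebra of all bounded linear operators on $\mathcal{X}$ and $F(\mathcal{X})$ is its ideal of finite rank operators. A standard operator algebra over $\mathcal{X}$ is any subalgebra of $B(\mathcal{X})$ containing $F(\mathcal{X})$ (no closedness is assumed). For elements of an algebra $\mathcal{U}$, $[a,b]=ab-ba$, and $p_n$ is defined recursively by $p_1(a_1)=a_1$ and $p_n(a_1,\dots,a_n)=[p_{n-1}(a_1,\dots,a_{n-1}),a_n]$ for $n\geq 2$. A linear map $\phi:\mathcal{U}\to\mathcal{U}$ is a Lie $n$-centralizer ($n\geq2$) if $\phi(p_n(a_1,a_2,\dots,a_n))=p_n(\phi(a_1),a_2,\dots,a_n)$ for all $a_1,\dots,a_n\in\mathcal{U}$. *)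

(* Defs.v *)
From HB Require Import structures.
From mathcomp Require Import all_boot all_order all_algebra.
From mathcomp Require Import all_classical all_reals all_analysis.
From mathcomp Require Import complex.

Set Implicit Arguments.
Unset Strict Implicit.
Unset Printing Implicit Defensive.

Import Order.TTheory GRing.Theory Num.Theory.
Import numFieldNormedType.Exports.
Local Open Scope ring_scope.
Local Open Scope complex_scope.

Definition linearly_independent (K : pzRingType) (V : lmodType K) (k : nat)
    (v : 'I_k -> V) : Prop :=
  forall c : 'I_k -> K, \sum_(i < k) c i *: v i = 0 -> forall i, c i = 0.

(* [dim V >= k]; [V] may be infinite-dimensional. *)
Definition dim_ge (K : pzRingType) (V : lmodType K) (k : nat) : Prop :=
  exists v : 'I_k -> V, linearly_independent v.

Section BoundedOperators.
Context {R : realType} (X : completeNormedModType R[i]).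

Definition bounded_linear (f : X -> X) : Prop :=
  linear f /\ exists M : R, forall x, `|f x| <= M%:C * `|x|.

Definition bounded_op_pred : {pred X -> X} := [pred f | `[< bounded_linear f >]].

Lemma bounded_op_submod_closed : submod_closed bounded_op_pred.
Proof.
split.
  apply/asboolP; split; first by move=> a x y; rewrite scaler0 addr0.
  by exists 0 => x; rewrite normr0 mul0r.
move=> a f g /asboolP[lf [M fM]] /asboolP[lg [N gN]]; apply/asboolP; split.
  move=> b x y; rewrite !fctE lf lg !scalerDr !scalerA mulrC -!addrA.
  by congr (_ + _); rewrite addrCA.
have /complex_realP[r ra] : `|a| \is Num.real by exact: normr_real.
exists (r * M + N) => x; rewrite !fctE rmorphD rmorphM/= -ra.
rewrite mulrDl (le_trans (ler_normD _ _))// lerD// normrZ -mulrA.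
by rewrite ler_wpM2l.
Qed.

HB.instance Definition _ :=
  GRing.isSubmodClosed.Build R[i] (X -> X) bounded_op_pred
    bounded_op_submod_closed.

Record bounded_op := BoundedOp {
  bounded_op_val :> X -> X;
  bounded_opP : bounded_op_val \in bounded_op_pred }.

HB.instance Definition _ := [isSub for bounded_op_val].
HB.instance Definition _ := [Choice of bounded_op by <:].
HB.instance Definition _ := [SubChoice_isSubLmodule of bounded_op by <:].

Lemma bounded_op_comp_subproof (A B : bounded_op) :
  (A \o B : X -> X) \in bounded_op_pred.
Proof.
have /asboolP[lf [M fM]] := bounded_opP A.
have /asboolP[lg [N gN]] := bounded_opP B.
apply/asboolP; split=> /=; first by move=> a x y /=; rewrite lg lf.
exists (`|M| * N) => x /=; apply: le_trans (fM _) _.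
have hM : M%:C <= `|M|%:C by rewrite lecR ler_norm.
apply: le_trans (ler_wpM2r (normr_ge0 _) hM) _.
by rewrite rmorphM -mulrA ler_wpM2l// lecR.
Qed.

Lemma bounded_op_id_subproof : (id : X -> X) \in bounded_op_pred.
Proof. by apply/asboolP; split=> //; exists 1 => x; rewrite mul1r. Qed.

Definition bounded_op_comp (A B : bounded_op) :=
  BoundedOp (bounded_op_comp_subproof A B).
Definition bounded_op_id := BoundedOp bounded_op_id_subproof.

Lemma bounded_op_linear (A : bounded_op) : linear A.
Proof. by have /asboolP[] := bounded_opP A. Qed.

Fact bounded_op_compA : associative bounded_op_comp.
Proof. by move=> A B C; apply: val_inj. Qed.
Fact bounded_op_comp1l : left_id bounded_op_id bounded_op_comp.
Proof. by move=> A; apply: val_inj. Qed.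
Fact bounded_op_comp1r : right_id bounded_op_id bounded_op_comp.
Proof. by move=> A; apply: val_inj. Qed.
Fact bounded_op_compDl : left_distributive bounded_op_comp +%R.
Proof. by move=> A B C; apply: val_inj. Qed.
Fact bounded_op_compDr : right_distributive bounded_op_comp +%R.
Proof.
move=> A B C; apply: val_inj; apply/funext => x /=.
by rewrite !fctE -[B x]scale1r bounded_op_linear !scale1r.
Qed.

HB.instance Definition _ :=
  GRing.Zmodule_isPzRing.Build bounded_op bounded_op_compA bounded_op_comp1l
    bounded_op_comp1r bounded_op_compDl bounded_op_compDr.

(* [X] may be trivial, so B(X) cannot be declared as an [algType], which is a
   nontrivial ring; only the two algebra axioms are recorded. *)
Fact bounded_op_scaleAl (a : R[i]) (A B : bounded_op) :
  a *: (A * B) = a *: A * B.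
Proof. exact: val_inj. Qed.

Fact bounded_op_scaleAr (a : R[i]) (A B : bounded_op) :
  a *: (A * B) = A * (a *: B).
Proof.
apply: val_inj; apply/funext => x /=; rewrite !fctE.
rewrite -[a *: B x]addr0 bounded_op_linear.
have -> : A 0 = 0 by rewrite -[0 in LHS](subrr 0) -scaleN1r addrC bounded_op_linear scaleN1r addNr.
by rewrite addr0.
Qed.

Definition finite_rank (A : bounded_op) : Prop :=
  exists (k : nat) (v : 'I_k -> X), forall x,
    exists c : 'I_k -> R[i], A x = \sum_(i < k) c i *: v i.

(* A subalgebra need not contain the identity here, unlike for the library's
   [subalgClosed]. *)
Record standard_operator_algebra := StandardOperatorAlgebra {
  soa_pred :> {pred bounded_op};
  soa_submod : submod_closed soa_pred;
  soa_mul : GRing.mulr_2closed soa_pred;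
  soa_finite_rank : forall A, finite_rank A -> A \in soa_pred }.

End BoundedOperators.

Section StandardOperatorAlgebraType.
Context {R : realType} {X : completeNormedModType R[i]}.
Variable U : standard_operator_algebra X.

HB.instance Definition _ :=
  GRing.isSubmodClosed.Build R[i] (bounded_op X) (soa_pred U) (soa_submod U).

(* The algebra [U] as a type, so that maps can be defined on [U] only. *)
Record soa_type := SoaType {
  soa_val :> bounded_op X;
  soa_valP : soa_val \in soa_pred U }.

HB.instance Definition _ := [isSub for soa_val].
HB.instance Definition _ := [Choice of soa_type by <:].
HB.instance Definition _ := [SubChoice_isSubLmodule of soa_type by <:].

Definition soa_prod (A B : soa_type) : soa_type :=
  SoaType (soa_mul (soa_valP A) (soa_valP B)).

End StandardOperatorAlgebraType.

(* There is no library structure for algebras without unit, hence the explicit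
   product [mul]. *)
Section LieCentralizers.
Context {K : pzRingType} {V : lmodType K} (mul : V -> V -> V).

Definition lie_bracket (a b : V) : V := mul a b - mul b a.

(* [lie_poly a1 [:: a2; ..; an]] is
   p_n(a1, ..., an) = [...[[a1, a2], a3], ..., an]. *)
Definition lie_poly (a : V) (s : seq V) : V := foldl lie_bracket a s.

Definition lie_centralizer (n : nat) (phi : {linear V -> V}) : Prop :=
  forall (a : V) (s : n.-1.-tuple V),
    phi (lie_poly a s) = lie_poly (phi a) s.

End LieCentralizers.

(* Main.v *)
Require Import Defs.
From HB Require Import structures.
From mathcomp Require Import all_boot all_order all_algebra.
From mathcomp Require Import all_classical all_reals all_analysis.
From mathcomp Require Import complex.
From mathcomp Require Import ring lra.

Set Implicit Arguments.
Unset Strict Implicit.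
Unset Printing Implicit Defensive.

Import Order.TTheory GRing.Theory Num.Theory.
Import numFieldNormedType.Exports.
Local Open Scope ring_scope.
Local Open Scope complex_scope.

(** The substance of the theorem is that a Lie n-centralizer [phi] has the form
    [lambda A + mu(A) I]. Given this form, scalar operators are killed by
    brackets, so that the centralizer identity says precisely that [mu] vanishes
    on the values of [p_n]; this settles both implications.

    Write [f (x) x] for the rank-one operator [z |-> f z *: x], where [f] is a
    bounded functional. The operators [P] with [f x = 1] are idempotents, and
    [ad P] has the same kernel as each of its positive powers: filling the last
    slots of [p_n] with such a [P] makes the number [n] of slots irrelevant
    ([lie_idempotent_ker]). In this way [phi P] commutes with [P], and
    [[phi A, B] - [A, phi B]] commutes with every rank-one idempotent.

    For a square-zero [N = f (x) x], with [f x = 0], there are idempotents [P]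
    and [Q] of rank one with the same range, respectively the same kernel, as
    [N]. Since [N] is an eigenvector of [ad P] and of [ad Q], the operator
    [phi N] is a bracket of [N] with [phi P], and also one of [N] with [phi Q].
    The first shows that [phi N] has range in the line of [x], the second that
    it factors through [f]; so [phi N = c N] ([phi_rank_one]).
    Next, [[phi A, N] - [A, phi N]] is the bracket [[T, N]] with
    [T = phi A - c A]. It commutes with rank-one idempotents, so each vector is
    an eigenvector of it, and evaluation at [x], at [y] with [f y = 1], and at
    [x + y] forces [T x] to be a multiple of [x] ([phi_local_eigen]). Taking for
    [A] another square-zero rank-one operator shows that [c] is the same for all
    lines outside the hyperplane [f = 0]. Hence [phi A - c A] is an operator for
    which every vector outside a hyperplane is an eigenvector, and such an
    operator is scalar ([scalar_of_local_eigen]).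

    The functionals come from the Hahn-Banach theorem, which is proved first
    for real sublinear functionals by taking a minimal one, and then transferred
    to complex normed spaces. *)

(** * Sublinear functionals and the Hahn-Banach theorem *)

Section SublinearFunctionals.
Context {R : realType} {V : lmodType R}.
Implicit Types (p : V -> R) (v x y : V) (t : R).

(** Homogeneity is only required as an inequality for positive scalars; applied
    to [t] and [t^-1] it gives the equality ([sublinearZ]). *)
Definition sublinear p : Prop :=
  (forall x y, p (x + y) <= p x + p y) /\
  (forall t x, 0 < t -> p (t *: x) <= t * p x).

Lemma sublinear0 p : sublinear p -> p 0 = 0.
Proof.
move=> [pD pZ]; have := pD 0 0; have := pZ 2^-1 0 ltac:(lra).
by rewrite scaler0 addr0 => *; lra.
Qed.

Lemma sublinearZ p t x : sublinear p -> 0 <= t -> p (t *: x) = t * p x.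
Proof.
move=> sp; rewrite le_eqVlt => /predU1P[<-|t0].
  by rewrite scale0r mul0r sublinear0.
have [_ pZ] := sp; apply/eqP; rewrite eq_le pZ//=.
have := pZ t^-1 (t *: x); rewrite invr_gt0 => /(_ t0).
by rewrite scalerK ?gt_eqF// ler_pdivlMl.
Qed.

Lemma sublinear_geN p x : sublinear p -> - p (- x) <= p x.
Proof.
by move=> sp; have := sp.1 x (- x); rewrite subrr sublinear0// => ?; lra.
Qed.

(** [S x] is the set of candidate values at [x]. This form covers both the
    infimum of a chain of functionals and the infimum of one functional along
    rays. *)
Lemma inf_sublinear (S : V -> set R) (b : V -> R) :
  (forall x, S x !=set0)%classic ->
  (forall x a, S x a -> b x <= a) ->
  (forall x y a c, S x a -> S y c -> exists2 d, S (x + y) d & d <= a + c) ->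
  (forall t x a, 0 < t -> S x a -> exists2 d, S (t *: x) d & d <= t * a) ->
  sublinear (fun x => inf (S x)).
Proof.
move=> S0 Sb SD SZ.
have infS x a : S x a -> inf (S x) <= a.
  by move=> Sxa; apply: ge_inf => //; exists (b x) => d; apply: Sb.
split=> [x y|t x t0].
  rewrite -lerBlDl; apply: lb_le_inf => // c Syc.
  rewrite lerBlDr -lerBlDl; apply: lb_le_inf => // a Sxa.
  have [d Sd dac] := SD _ _ _ _ Sxa Syc.
  by rewrite lerBlDr; apply: le_trans dac; apply: infS.
rewrite -ler_pdivrMl//; apply: lb_le_inf => // a Sxa.
have [d Sd da] := SZ _ _ _ t0 Sxa.
by rewrite ler_pdivrMl//; apply: le_trans da; apply: infS.
Qed.

(** The infimum of [p (x + t *: v) - t * p v] over [t >= 0] is still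
    sublinear; its term [t = 0] is [p x], and at [x = - v] the term [t = 1]
    gives the last inequality. *)
Lemma sublinear_tilt p v : sublinear p ->
  exists q, [/\ sublinear q, forall x, q x <= p x & q (- v) <= - p v].
Proof.
move=> sp.
pose S x := [set a | exists2 t, 0 <= t & a = p (x + t *: v) - t * p v]%classic.
have Sb x a : S x a -> - p (- x) <= a.
  move=> [t t0 ->]; have := sp.1 (x + t *: v) (- x).
  by rewrite addrC addKr sublinearZ// => ?; lra.
have infS x a : S x a -> inf (S x) <= a.
  by move=> Sxa; apply: ge_inf => //; exists (- p (- x)) => d; apply: Sb.
have Sp x : S x (p x) by exists 0; rewrite ?scale0r ?addr0 ?mul0r ?subr0.
exists (fun x => inf (S x)); split.
- apply: (inf_sublinear (b := fun x => - p (- x))) => //.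
  + by move=> x; exists (p x).
  + move=> x y _ _ [s s0 ->] [t t0 ->].
    exists (p (x + y + (s + t) *: v) - (s + t) * p v).
      by exists (s + t) => //; lra.
    have := sp.1 (x + s *: v) (y + t *: v).
    by rewrite addrACA -scalerDl => ?; lra.
  + move=> t x _ t0 [s s0 ->].
    exists (p (t *: x + (t * s) *: v) - (t * s) * p v).
      by exists (t * s) => //; apply: mulr_ge0 => //; apply: ltW.
    have := sp.2 t (x + s *: v) t0.
    by rewrite scalerDr scalerA mulrBr mulrA lerD2r.
- by move=> x; apply: infS.
- by apply: infS; exists 1; rewrite // scale1r addNr sublinear0// mul1r sub0r.
Qed.

(** Zorn's lemma downwards: the pointwise infimum of a chain of sublinear
    functionals is sublinear, the bound [- p (- x)] keeping it finite. *)
Lemma sublinear_minimal p : sublinear p ->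
  exists q, [/\ sublinear q, forall x, q x <= p x &
    forall r, sublinear r -> (forall x, r x <= q x) -> r = q].
Proof.
move=> sp; pose T := {q : V -> R | sublinear q /\ forall x, q x <= p x}.
pose below (q r : T) := `[< forall x, sval r x <= sval q x >].
have [q|q r s|q r|C chainC|[q [sq qp]] qmin] := @Zorn T below.
- exact/asboolP.
- move=> /asboolP qr /asboolP rs; apply/asboolP => x.
  exact: le_trans (rs x) (qr x).
- case: q r => [q sq] [r sr] /asboolP/= qr /asboolP/= rq.
  by apply/eq_exist/funext => x; apply/eqP; rewrite eq_le qr rq.
- have [[q0 Cq0]|C0] := pselect (exists q, C q); last first.
    exists (exist _ p (conj sp (fun x => lexx _))) => q Cq.
    by case: C0; exists q.
  pose S x := [set sval q x | q in C]%classic.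
  have Sb x a : S x a -> - p (- x) <= a.
    move=> [[q [sq qp]] _ <-] /=; have := qp (- x).
    by have := sublinear_geN x sq => *; lra.
  have infS x q : C q -> inf (S x) <= sval q x.
    move=> Cq; apply: ge_inf; last by exists q.
    by exists (- p (- x)) => d; apply: Sb.
  have sinf : sublinear (fun x => inf (S x)).
    apply: (inf_sublinear (b := fun x => - p (- x))) => //.
    + by move=> x; exists (sval q0 x), q0.
    + move=> x y _ _ [q Cq <-] [r Cr <-].
      have [qr|rq] := chainC q r Cq Cr.
        exists (sval r (x + y)); first by exists r.
        apply: le_trans ((svalP r).1.1 _ _) _; rewrite lerD2r.
        by move/asboolP: qr.
      exists (sval q (x + y)); first by exists q.
      apply: le_trans ((svalP q).1.1 _ _) _; rewrite lerD2l.
      by move/asboolP: rq.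
    + move=> t x _ t0 [q Cq <-]; exists (sval q (t *: x)); first by exists q.
      exact: (svalP q).1.2.
  have infp x : inf (S x) <= p x.
    exact: le_trans (infS x q0 Cq0) ((svalP q0).2 x).
  exists (exist _ (fun x => inf (S x)) (conj sinf infp)) => q Cq.
  by apply/asboolP => x; apply: infS.
- exists q; split=> // r sr rq.
  have rp x : r x <= p x by apply: le_trans (rq x) (qp x).
  have := qmin (exist _ r (conj sr rp)).
  by move=> /(_ (asboolT rq))[].
Qed.

(** A minimal sublinear functional is linear: tilting cannot lower it, so that
    [q (- v) <= - q v] for all [v], and a sublinear [q] with this property is
    odd, hence additive. Tilting [p] towards [v] beforehand makes the minimal
    functional below it take the value [p v] at [v]. *)
Theorem hahn_banach_sublinear p v : sublinear p ->
  exists f : {scalar V}, (forall x, f x <= p x) /\ f v = p v.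
Proof.
move=> sp; have [p' [sp' p'p p'v]] := sublinear_tilt v sp.
have [q [sq qp' qmin]] := sublinear_minimal sp'.
have qN x : q (- x) = - q x.
  have [r [sr rq rN]] := sublinear_tilt x sq.
  have <- := qmin r sr rq; have := sublinear_geN x sr.
  by have := rq x => *; lra.
have qD x y : q (x + y) = q x + q y.
  have := sq.1 x y; have := sq.1 (x + y) (- y).
  by rewrite addrK qN => *; lra.
have qZ t x : q (t *: x) = t * q x.
  have [t0|t0] := leP 0 t; first exact: sublinearZ.
  by rewrite -[t]opprK scaleNr qN sublinearZ ?mulNr//; lra.
have qlin : scalar q by move=> t x y; rewrite qD qZ.
exists (HB.pack_for {scalar V} q (GRing.isLinear.Build _ _ _ _ q qlin)).
split=> [x|] /=; first exact: le_trans (qp' x) (p'p x).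
have := qp' (- v); have := qp' v; have := p'p v; rewrite qN => *; lra.
Qed.

End SublinearFunctionals.

(** * Bounded functionals on a complex normed space *)

(** A complex vector space with its scalars restricted to the reals; an alias,
    so that the two module structures do not compete for the same type. *)
Definition realification {R : realType} (V : lmodType R[i]) : Type := V.

Section Realification.
Context {R : realType} (V : lmodType R[i]).
Local Notation VR := (realification V).

HB.instance Definition _ := GRing.Zmodule.on VR.

Definition realification_scale (t : R) (x : VR) : VR := t%:C *: (x : V).

Fact realification_scaleA s t x :
  realification_scale s (realification_scale t x) =
  realification_scale (s * t) x.
Proof. by rewrite /realification_scale scalerA -rmorphM. Qed.
Fact realification_scale1 : left_id 1 realification_scale.
Proof. by move=> x; rewrite /realification_scale scale1r. Qed.
Fact realification_scaleDr : right_distributive realification_scale +%R.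
Proof. by move=> t x y; apply: scalerDr. Qed.
Fact realification_scaleDl x :
  {morph realification_scale^~ x : s t / s + t >-> s + t}.
Proof. by move=> s t; rewrite /realification_scale rmorphD scalerDl. Qed.

HB.instance Definition _ := GRing.Zmodule_isLmodule.Build R VR
  realification_scaleA realification_scale1 realification_scaleDr
  realification_scaleDl.

Lemma realification_scaleE (t : R) (x : VR) : t *: x = t%:C *: (x : V).
Proof. by []. Qed.

(** A real-linear functional is the real part of the complex-linear functional
    [f x - i f (i x)]. *)
Lemma complexify_functional (f : {scalar VR}) :
  exists g : {scalar V},
    forall x, g x = f (x : VR) +i* (- f ('i *: x : V)).
Proof.
pose g (x : V) := f (x : VR) +i* (- f ('i *: x : V)).
have fD (x y : V) : f (x + y : V) = f (x : VR) + f (y : VR) by apply: linearD.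
have fR t (x : V) : f (t%:C *: x : V) = t * f (x : VR) by apply: scalarZ.
have fZ (a : R[i]) (x : V) :
    f (a *: x : V) = complex.Re a * f (x : VR) + complex.Im a * f ('i *: x : V).
  by rewrite [a in LHS]complexE [_ * _%:C]mulrC scalerDl -scalerA fD !fR.
have glin : scalar g.
  move=> a x y; rewrite /g scalerDr scalerA !fD (fZ a) (fZ ('i * a)).
  case: a => r s; apply/eqP; rewrite eq_complex /=.
  by apply/andP; split; apply/eqP; ring.
by exists (HB.pack_for {scalar V} g (GRing.isLinear.Build _ _ _ _ g glin)).
Qed.

End Realification.

Section BoundedFunctionals.
Context {R : realType} {X : normedModType R[i]}.
Implicit Types (x y : X).

Definition bounded_functional (f : X -> R[i]) : Prop :=
  exists M : R, forall x, `|f x| <= M%:C * `|x|.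

Let nrm x : R := complex.Re `|x|.

Let nrmE x : (nrm x)%:C = `|x|.
Proof. exact: RRe_real (normr_real x). Qed.

Lemma sublinear_norm : sublinear (nrm : realification X -> R).
Proof.
split=> [x y|t x t0]; rewrite -lecR.
  by rewrite rmorphD /= !nrmE ler_normD.
rewrite rmorphM /= !nrmE realification_scaleE normrZ ger0_norm//.
by rewrite ler0c ltW.
Qed.

(** The real functional that Hahn-Banach gives below the norm is nonzero at [v],
    and so is its complexification, whose bound is at most twice as large. *)
Lemma bounded_functional_neq0 v : v != 0 ->
  exists2 f : {scalar X}, bounded_functional f & f v = 1.
Proof.
move=> v0.
have [f [fle fv]] := hahn_banach_sublinear (v : realification X) sublinear_norm.
have fabs x : `|f (x : realification X)| <= nrm x.
  rewrite ler_norml fle andbT lerNl -linearN.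
  by apply: le_trans (fle _) _; rewrite /nrm normrN.
have [g gE] := complexify_functional f.
have gv0 : g v != 0.
  rewrite gE eq_complex /= fv negb_and; apply/orP; left.
  by apply: contra v0 => /eqP nv; rewrite -normr_eq0 -nrmE nv.
have normi : `|'i%C| = 1 :> R[i].
  by rewrite normc_def /= expr0n expr1n add0r sqrtr1.
have gb x : `|g x| <= (2 * nrm x)%:C.
  rewrite gE [_ +i* _]complexE /=; apply: le_trans (ler_normD _ _) _.
  rewrite normrM.
  have normC (t : R) : `|t%:C| = `|t|%:C.
    by rewrite normc_def /= expr0n addr0 sqrtr_sqr.
  rewrite normi mul1r !normC -rmorphD lecR mulr_natl mulr2n lerD// normrN.
  apply: le_trans (fabs _) _; rewrite -lecR !nrmE normrZ.
  by rewrite normi mul1r.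
pose h x := (g v)^-1 * g x; have hlin : scalar h.
  by move=> a x y; rewrite /h linearP mulrDr mulrCA.
exists (HB.pack_for {scalar X} h (GRing.isLinear.Build _ _ _ _ h hlin)) => /=.
  have := normr_real (g v)^-1 => /complex_realP[c cE].
  exists (c * 2) => x; rewrite normrM cE rmorphM -mulrA ler_wpM2l//.
    by rewrite -cE.
  by apply: le_trans (gb x) _; rewrite rmorphM /= nrmE.
by rewrite /h mulVf.
Qed.

(** Two functionals suffice: [f] with [f y = 1] produces the nonzero vector
    [x - f x *: y], and correcting by [f] a functional [h] that is [1] there
    makes it vanish at [y]. *)
Lemma bounded_functional_separates x y : y != 0 ->
  (forall c, x != c *: y) ->
  exists f : {scalar X}, [/\ bounded_functional f, f y = 0 & f x = 1].
Proof.
move=> y0 xy; have [f [M fM] fy] := bounded_functional_neq0 y0.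
have [|h [N hN] hx] := @bounded_functional_neq0 (x - f x *: y).
  by rewrite subr_eq0.
pose g z := h z - h y * f z; have glin : scalar g.
  by move=> a u v; rewrite /g !linearP /=; ring.
exists (HB.pack_for {scalar X} g (GRing.isLinear.Build _ _ _ _ g glin)).
split=> /=; last 2 first.
- by rewrite /g fy mulr1 subrr.
- by rewrite /g -hx linearB scalarZ mulrC.
have /complex_realP[c cE] := normr_real (h y).
exists (N + c * M) => z; apply: le_trans (ler_normB _ _) _.
rewrite normrM cE rmorphD /= rmorphM mulrDl lerD// -mulrA ler_wpM2l//.
by rewrite -cE.
Qed.

End BoundedFunctionals.

(** * Operators acting pointwise *)

Section OperatorsPointwise.
Context {R : realType} {X : completeNormedModType R[i]}.

HB.instance Definition _ (A : bounded_op X) :=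
  GRing.isLinear.Build R[i] X X *:%R A (bounded_op_linear A).

Context {U : standard_operator_algebra X}.
Implicit Types (A B D N P : soa_type U) (x y z : X).

Local Notation bracket := (lie_bracket (@soa_prod R X U)).
Local Notation lie := (lie_poly (@soa_prod R X U)).

Lemma soa_ext A B : (forall z, A z = B z) -> A = B.
Proof. by move=> AB; do 2 apply: val_inj; apply/funext. Qed.

Lemma soa_addE A B z : (A + B) z = A z + B z. Proof. by []. Qed.
Lemma soa_subE A B z : (A - B) z = A z - B z. Proof. by []. Qed.
Lemma soa_scaleE a A z : (a *: A) z = a *: A z. Proof. by []. Qed.

Lemma bracketE A B z : bracket A B z = A (B z) - B (A z).
Proof. by []. Qed.

Lemma bracketC A B : bracket A B = - bracket B A.
Proof. by rewrite /lie_bracket opprB. Qed.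

Lemma bracketxx A : bracket A A = 0.
Proof. exact: subrr. Qed.

Lemma bracket_eq0 A B : bracket A B = 0 -> forall z, A (B z) = B (A z).
Proof. by move=> AB0 z; apply/subr0_eq; rewrite -bracketE AB0. Qed.

Lemma bracketBl A A' B : bracket (A - A') B = bracket A B - bracket A' B.
Proof.
apply: soa_ext => z; rewrite [LHS]bracketE [RHS]soa_subE !bracketE.
rewrite !soa_subE linearB.
by rewrite !opprD !opprK addrACA.
Qed.

Lemma bracketZl a A B : bracket (a *: A) B = a *: bracket A B.
Proof.
apply: soa_ext => z; rewrite [LHS]bracketE [RHS]soa_scaleE bracketE.
by rewrite !soa_scaleE linearZ scalerBr.
Qed.

Lemma lieB A A' s : lie (A - A') s = lie A s - lie A' s.
Proof. by elim: s A A' => //= B s IH A A'; rewrite bracketBl IH. Qed.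

Lemma lieZ a A s : lie (a *: A) s = a *: lie A s.
Proof. by elim: s A => //= B s IH A; rewrite bracketZl IH. Qed.

Lemma lie0 s : lie 0 s = 0.
Proof. by rewrite -(scale0r 0) lieZ !scale0r. Qed.

Definition idempotent_op P : Prop := forall z, P (P z) = P z.

(** The diagonal corners [P [D, P] P] and [(1 - P) [D, P] (1 - P)] always
    vanish; if [[D, P]] commutes with [P], so do its off-diagonal corners. *)
Lemma bracket_idempotent_ker D P : idempotent_op P ->
  bracket (bracket D P) P = 0 -> bracket D P = 0.
Proof.
move=> PP DPP0; have EP := bracket_eq0 DPP0.
have EP0 z : bracket D P (P z) = 0.
  by rewrite -(PP z) EP bracketE linearB /= !PP subrr.
apply: soa_ext => z; have := EP0 z; rewrite EP !bracketE linearB /= PP.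
by move=> /subr0_eq <-; have := EP0 z; rewrite bracketE PP.
Qed.

(** This is what reduces brackets of arbitrary length to simple ones. The case
    [k = 0] allows [n = 2] to be treated together with the others. *)
Lemma lie_idempotent_ker k D P : idempotent_op P ->
  lie D (nseq k P) = 0 -> bracket D P = 0.
Proof.
move=> PP; elim: k D => [|k IH] D /=; first by move=> ->; apply: (lie0 [:: P]).
by move=> /IH; apply: bracket_idempotent_ker.
Qed.

Lemma lie_eigen k c N P :
  bracket N P = c *: N -> lie N (nseq k P) = c ^+ k *: N.
Proof.
move=> NP; elim: k => [|k IH] /=; first by rewrite scale1r.
by rewrite NP lieZ IH scalerA -exprS.
Qed.

Lemma rank_one_soa x (f : {scalar X}) : bounded_functional f ->
  exists A : soa_type U, forall z, A z = f z *: x.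
Proof.
move=> [M fM].
have bA : (fun z => f z *: x) \in @bounded_op_pred R X.
  apply/asboolP; split; first by move=> a y z; rewrite linearP scalerDl scalerA.
  have /complex_realP[c cE] := normr_real x.
  exists (M * c) => z; rewrite normrZ rmorphM /= -cE mulrAC.
  exact: ler_wpM2r.
have AU : BoundedOp bA \in soa_pred U.
  apply: soa_finite_rank; exists 1, (fun=> x) => z; exists (fun=> f z).
  by rewrite big_ord1.
by exists (SoaType AU).
Qed.

Lemma rank_one_idempotent x (f : {scalar X}) P :
  f x = 1 -> (forall z, P z = f z *: x) -> idempotent_op P.
Proof. by move=> fx PE z; rewrite !PE scalarZ fx mulr1. Qed.

End OperatorsPointwise.

(** For [z] in the kernel of [f], both [y + z] and [y - z] are eigenvectors. The
    sum of their two eigenvalue equations is an identity between [y] and [z],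
    which forces the eigenvalues to agree with that of [y] unless [z = 0]. *)
Lemma scalar_of_local_eigen (K : numFieldType) (V : lmodType K)
    (T : {linear V -> V}) (f : {scalar V}) (y : V) : f y = 1 ->
  (forall z, f z != 0 -> exists c, T z = c *: z) ->
  exists c, forall z, T z = c *: z.
Proof.
move=> fy Tz.
have [|c Ty] := Tz y; first by rewrite fy oner_eq0.
have Tker z : f z = 0 -> T z = c *: z.
  move=> fz.
  have [|d Td] := Tz (y + z); first by rewrite linearD fz fy addr0 oner_eq0.
  have [|e Te] := Tz (y - z); first by rewrite linearB fz fy subr0 oner_eq0.
  move: Td Te; rewrite linearB linearD Ty /= => Td Te.
  have sumE : (d + e) *: y + (d - e) *: z = (c + c) *: y.
    rewrite scalerBl !scalerDl addrACA -(scalerDr d) -(scalerBr e) -Td -Te.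
    by rewrite addrACA subrr addr0.
  have := congr1 f sumE; rewrite linearD !scalarZ fz fy mulr0 addr0 !mulr1.
  move=> de; move/eqP: sumE; rewrite de -subr_eq0 addrAC subrr add0r.
  rewrite scaler_eq0 subr_eq0 => /orP[/eqP de'|/eqP ->]; last first.
    by rewrite linear0 scaler0.
  have dc : d = c.
    apply: (@mulIf _ 2); first by rewrite pnatr_eq0.
    by rewrite !mulr_natr !mulr2n -de de'.
  by move: Td; rewrite dc scalerDr => /addrI.
exists c => z; rewrite -[z in LHS](subrK (f z *: y)) linearD.
rewrite [T (_ *: _)]linearZ /= Ty.
rewrite Tker; last by rewrite linearB scalarZ fy mulr1 subrr.
by rewrite scalerBr scalerA mulrC -scalerA subrK.
Qed.

(** * Lie centralizers on a standard operator algebra *)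

Section LieCentralizer.
Context {R : realType} {X : completeNormedModType R[i]}.
Context {U : standard_operator_algebra X}.
Variables (m : nat) (phi : {linear soa_type U -> soa_type U}).
Hypothesis phiP : lie_centralizer (@soa_prod R X U) m.+2 phi.
Implicit Types (A B D N P : soa_type U) (x y z : X).

Local Notation bracket := (lie_bracket (@soa_prod R X U)).
Local Notation lie := (lie_poly (@soa_prod R X U)).

Lemma phi_lie A B (s : m.-tuple (soa_type U)) :
  phi (lie (bracket A B) s) = lie (bracket (phi A) B) s.
Proof. exact: (phiP A [tuple of B :: s]). Qed.

Lemma phi_idempotent P : idempotent_op P -> bracket (phi P) P = 0.
Proof.
move=> PP; apply: (@lie_idempotent_ker _ _ _ m.+1) => //=.
by rewrite -(phi_lie P P (nseq_tuple m P)) bracketxx lie0 linear0.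
Qed.

(** If [N = [A, B]] is an eigenvector of [ad P], then up to a power of the
    eigenvalue [N] is [p_n(A, B, P, ..., P)], and [phi] acts on the first slot.
    The assumption on [[phi A, B]] allows the same power to be cancelled. *)
Lemma phi_bracket c N A B P : c != 0 ->
  bracket A B = N -> bracket N P = c *: N ->
  bracket (bracket (phi A) B) P = c *: bracket (phi A) B ->
  phi N = bracket (phi A) B.
Proof.
move=> c0 AB NP MP; have := phi_lie A B (nseq_tuple m P).
rewrite AB /= (lie_eigen _ NP) (lie_eigen _ MP) linearZ.
exact/scalerI/expf_neq0.
Qed.

(** By antisymmetry of the inner bracket, [phi] of [p_n(A, B, ...)] can be
    computed by acting either on [A] or on [B]. *)
Lemma phi_defect_commutes A B P : idempotent_op P ->
  bracket (bracket (phi A) B - bracket A (phi B)) P = 0.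
Proof.
move=> PP; apply: (@lie_idempotent_ker _ _ _ m) => //.
rewrite lieB -(phi_lie A B (nseq_tuple m P)).
rewrite [bracket A (phi B)]bracketC.
rewrite -(scaleN1r (bracket (phi B) A)) lieZ.
rewrite -(phi_lie B A (nseq_tuple m P)) [bracket A B]bracketC.
by rewrite -(scaleN1r (bracket B A)) lieZ linearZ subrr.
Qed.

(** With [g x = 1], the idempotents [P = g (x) x] and [Q = f (x) y] satisfy
    [[P, N] = N] and [[N, Q] = N]. As [phi P] commutes with [P], the operator
    [phi N = [phi P, N]] has range in the line of [x]; as [phi Q] commutes with
    [Q], the operator [phi (- N) = [phi Q, N]] vanishes on the kernel of [f]. *)
Lemma phi_rank_one x y (f : {scalar X}) N : bounded_functional f ->
  f x = 0 -> f y = 1 -> x != 0 -> (forall z, N z = f z *: x) ->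
  exists c, phi N = c *: N.
Proof.
move=> fb fx fy x0 NE.
have [g gb gx] := bounded_functional_neq0 x0.
have [P PE] := @rank_one_soa _ _ U x g gb.
have [Q QE] := @rank_one_soa _ _ U y f fb.
have phiPx : phi P x = g (phi P x) *: x.
  have := bracket_eq0 (phi_idempotent (rank_one_idempotent gx PE)) x.
  by rewrite PE gx scale1r PE.
have phiQf z : f (phi Q z) = f z * f (phi Q y).
  have := bracket_eq0 (phi_idempotent (rank_one_idempotent fy QE)) z.
  rewrite !QE linearZ => /(congr1 f) /=.
  by rewrite !scalarZ fy mulr1.
(* [ad P] is [-1] on the operators into the line of [x] that vanish at [x]. *)
have adP (M : soa_type U) (h : X -> R[i]) :
    (forall z, M z = h z *: x) -> M x = 0 -> bracket M P = -1 *: M.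
  move=> ME Mx; apply: soa_ext => z; rewrite bracketE soa_scaleE scaleN1r.
  by rewrite !PE linearZ /= Mx scaler0 sub0r ME scalarZ gx mulr1.
(* [ad Q] is [1] on the operators [f (x) w] with [w] in the kernel of [f]. *)
have adQ (M : soa_type U) w :
    (forall z, M z = f z *: w) -> f w = 0 -> bracket M Q = 1 *: M.
  move=> ME fw; apply: soa_ext => z; rewrite bracketE soa_scaleE scale1r.
  by rewrite !QE linearZ /= !ME scalarZ fw mulr0 scale0r subr0 fy scale1r.
have Nx : N x = 0 by rewrite NE fx scale0r.
have phiNx z : exists d, phi N z = d *: x.
  have ME u : bracket (phi P) N u = (f u * g (phi P x) - f (phi P u)) *: x.
    by rewrite bracketE !NE linearZ /= phiPx scalerA -scalerBl scalarZ gx mulr1.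
  exists (f z * g (phi P x) - f (phi P z)); rewrite -ME.
  have -> // : phi N = bracket (phi P) N.
  apply: (@phi_bracket (-1) N P N P).
  - by rewrite oppr_eq0 oner_eq0.
  - by rewrite bracketC (adP _ _ NE Nx) scaleN1r opprK.
  - exact: (adP _ _ NE Nx).
  - apply: (adP _ _ ME).
    by rewrite ME fx mul0r phiPx scalarZ fx mulr0 subrr scale0r.
have [w phiNw] : exists w, forall z, phi N z = f z *: w.
  pose w := phi Q x - f (phi Q y) *: x.
  have ME u : bracket (phi Q) N u = f u *: w.
    by rewrite bracketE !NE linearZ /= phiQf scalerBr scalerA.
  exists (- w) => z; rewrite scalerN -ME -[N in LHS]opprK linearN.
  have -> // : phi (- N) = bracket (phi Q) N.
  apply: (@phi_bracket 1 (- N) Q N Q).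
  - exact: oner_neq0.
  - by rewrite bracketC (adQ _ _ NE fx) scale1r.
  - rewrite -scaleN1r; apply: (adQ _ (- x)) => [u|]; last first.
      by rewrite linearN fx oppr0.
    by rewrite soa_scaleE NE scaleN1r scalerN.
  - apply: (adQ _ _ ME).
    by rewrite linearB scalarZ (phiQf x) fx mul0r mulr0 subrr.
have [c cE] := phiNx y; exists c; apply: soa_ext => z.
by rewrite soa_scaleE phiNw NE -[w]scale1r -fy -phiNw cE !scalerA mulrC.
Qed.

(** The defect [D] of the centralizer identity is [[T, N]] with
    [T = phi A - c A], that is, [D z = f z *: T x - f (T z) *: x]. Every vector
    is an eigenvector of [D]; because [x + y] is one, [x] and [y] have the same
    eigenvalue. It is [- f (T x)] at [x] and [f (T x)] at [y], so it is zero,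
    and then [D y = 0] expresses [T x] as a multiple of [x]. *)
Lemma phi_local_eigen c x y (f : {scalar X}) N A : bounded_functional f ->
  f x = 0 -> f y = 1 -> x != 0 -> (forall z, N z = f z *: x) ->
  phi N = c *: N -> exists d, phi A x - c *: A x = d *: x.
Proof.
move=> fb fx fy x0 NE phiN; pose T z := phi A z - c *: A z.
pose D := bracket (phi A) N - bracket A (phi N).
have DE z : D z = f z *: T x - f (T z) *: x.
  rewrite [LHS]soa_subE !bracketE phiN !soa_scaleE !NE.
  rewrite [phi A (_ *: _)]linearZ [A _]linearZ /= [A (_ *: _)]linearZ /=.
  rewrite /T (linearB f) scalarZ scalerBr scalerBl !opprB !scalerA.
  by rewrite [c * f z]mulrC addrACA [- _ - _]addrC addrACA.
have Deigen v : v != 0 -> exists e, D v = e *: v.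
  move=> /bounded_functional_neq0[g gb gv].
  have [P PE] := @rank_one_soa _ _ U v g gb.
  have := bracket_eq0 (phi_defect_commutes A N (rank_one_idempotent gv PE)) v.
  by rewrite -/D !PE gv scale1r => ->; exists (g (D v)).
have fneq0 v : f v = 1 -> v != 0.
  move=> fv; apply/eqP => v0; move/eqP: fv.
  by rewrite v0 linear0 eq_sym oner_eq0.
have fxy : f (x + y) = 1 by rewrite linearD /= fx fy add0r.
have [d1 Dy] := Deigen y (fneq0 _ fy).
have [d2 Dxy] := Deigen (x + y) (fneq0 _ fxy).
have Dx : D x = - f (T x) *: x by rewrite DE fx scale0r sub0r scaleNr.
have fTx : f (T x) = d1.
  have := congr1 f Dy; rewrite DE fy scale1r linearB !scalarZ fx fy.
  by rewrite mulr0 subr0 mulr1.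
have DD : D (x + y) = D x + D y by rewrite linearD.
move: Dxy; rewrite DD Dx Dy fTx => Dxy.
have d12 : d1 = d2.
  have := congr1 f Dxy; rewrite linearD !scalarZ fxy fx fy.
  by rewrite mulr0 add0r !mulr1.
have d10 : d1 = 0.
  move: Dxy; rewrite -d12 scalerDr => /addIr/eqP.
  rewrite -subr_eq0 -scalerBl scaler_eq0 (negPf x0) orbF -opprD oppr_eq0.
  by rewrite -mulr2n mulrn_eq0 => /eqP.
exists (f (T y)); have := Dy; rewrite d10 scale0r DE fy scale1r.
exact/subr0_eq.
Qed.

(** Fix a square-zero [N = f (x) x]. A vector [z] with [f z != 0] is not on the
    line of [x], so there is [g] with [g z = 0] and [g x = 1]. Comparing
    [M = g (x) z] with [N] at [x], where [M x = z], shows that the factors of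
    [phi] on [M] and on [N] coincide. *)
Lemma phi_local_eigen_everywhere (hX : dim_ge X 2) :
  exists (c : R[i]) (f : {scalar X}) (y : X), f y = 1 /\
    forall A z, f z != 0 -> exists d, phi A z - c *: A z = d *: z.
Proof.
have [v vfree] := hX; pose x := v ord0; pose y := v ord_max.
have vxy a b : a *: x + b *: y = 0 -> a = 0 /\ b = 0.
  move=> ab0; have := vfree (fun i => if i == ord0 then a else b).
  rewrite !big_ord_recl big_ord0 addr0 /=.
  have -> : lift ord0 ord0 = ord_max :> 'I_2 by apply: val_inj.
  by move=> /(_ ab0) ab; have := ab ord0; have := ab ord_max.
have x0 : x != 0.
  apply/eqP => x0; have [] := vxy 1 0.
    by rewrite x0 scaler0 scale0r addr0.
  by move/eqP; rewrite oner_eq0.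
have xy c : y != c *: x.
  apply/eqP => yx; have [] := vxy c (-1).
    by rewrite yx scaleN1r subrr.
  by move=> _ /eqP; rewrite oppr_eq0 oner_eq0.
have [f [fb fx fy]] := bounded_functional_separates x0 xy.
have [N NE] := @rank_one_soa _ _ U x f fb.
have [c phiN] := phi_rank_one fb fx fy x0 NE.
exists c, f, y; split=> // A z fz.
have z0 : z != 0 by apply: contraNneq fz => ->; rewrite linear0.
have zx a : x != a *: z.
  apply/eqP => xaz; have /eqP := fx.
  rewrite xaz scalarZ mulf_eq0 (negPf fz) orbF.
  by move=> /eqP a0; move: x0; rewrite xaz a0 scale0r eqxx.
have [g [gb gz gx]] := bounded_functional_separates z0 zx.
have [M ME] := @rank_one_soa _ _ U z g gb.
have [c' phiM] := phi_rank_one gb gz gx z0 ME.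
have [d] := phi_local_eigen M fb fx fy x0 NE phiN.
rewrite phiM soa_scaleE ME gx scale1r -scalerBl => /(congr1 f).
rewrite !scalarZ fx mulr0 => /eqP; rewrite mulf_eq0 (negPf fz) orbF subr_eq0.
move=> /eqP c'c; apply: phi_local_eigen gb gz gx z0 ME _.
by rewrite phiM c'c.
Qed.

End LieCentralizer.

Theorem proposition5p1 (R : realType) (X : completeNormedModType R[i])
    (hX : dim_ge X 2) (U : standard_operator_algebra X)
    (hU : (1 : bounded_op X) \in soa_pred U)
    (n : nat) (hn : (2 <= n)%N) (phi : {linear soa_type U -> soa_type U}) :
  lie_centralizer (@soa_prod R X U) n phi <->
  exists (lambda : R[i]) (mu : {linear soa_type U -> R[i]^o}),
    (forall A : soa_type U,
       phi A = lambda *: A + mu A *: SoaType hU) /\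
    (forall (A : soa_type U) (s : n.-1.-tuple (soa_type U)),
       mu (lie_poly (@soa_prod R X U) A s) = 0).
Proof.
case: n hn => [|[|m]]// _.
pose I : soa_type U := SoaType hU.
have IE z : I z = z by [].
have [v vfree] := hX.
have v0 : v ord0 != 0.
  apply/eqP => v00; have := vfree (fun i => if i == ord0 then 1 else 0).
  rewrite !big_ord_recl big_ord0 /= v00 scaler0 scale0r !addr0.
  by move=> /(_ erefl ord0)/eqP; rewrite oner_eq0.
have I_inj (a : R[i]) : a *: I = 0 -> a = 0.
  move=> aI; have := congr1 (fun A : soa_type U => A (v ord0)) aI.
  by rewrite soa_scaleE IE => /eqP; rewrite scaler_eq0 (negPf v0) orbF => /eqP.
have lie_shift (a b : R[i]) A (s : m.+1.-tuple (soa_type U)) :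
    lie_poly (@soa_prod R X U) (a *: A + b *: I) s =
    a *: lie_poly (@soa_prod R X U) A s.
  case: s => -[|B s] //= _; rewrite -lieZ -bracketZl; congr lie_poly.
  apply: soa_ext => z; rewrite !bracketE !soa_addE !soa_scaleE !IE.
  rewrite linearD /= [B (b *: z)]linearZ /=.
  by rewrite opprD addrACA subrr addr0.
split=> [phiP|[lambda [mu [phiE mu0]]] A s]; last first.
  by rewrite !phiE mu0 scale0r addr0 lie_shift.
have [c [f [y [fy phic]]]] := phi_local_eigen_everywhere phiP hX.
have phi_scalar A : exists d, phi A - c *: A = d *: I.
  pose T := bounded_op_val (soa_val (phi A - c *: A)).
  have [] := scalar_of_local_eigen (T := T) fy; first exact: phic.
  by move=> d dE; exists d; apply: soa_ext => z; rewrite dE.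
have [mu muE] := choice phi_scalar.
have mulin : linear (mu : soa_type U -> R[i]^o).
  move=> a A B; apply/subr0_eq/I_inj.
  rewrite scalerBl scalerDl -scalerA -!muE linearP.
  by rewrite scalerDr !scalerA mulrC opprD addrACA scalerBr scalerA subrr.
exists c, (HB.pack_for {linear soa_type U -> R[i]^o} mu
  (GRing.isLinear.Build _ _ _ _ mu mulin)).
have phiE A : phi A = c *: A + mu A *: I by rewrite -muE addrCA subrr addr0.
split=> [|A s] //=; apply: I_inj.
have := phiP A s; rewrite [RHS]/= [in RHS]phiE lie_shift phiE.
by move/eqP; rewrite -subr_eq0 addrAC subrr add0r => /eqP.
Qed.
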